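(* Let $\mathbf{w}=[w_0,\dots,w_{N-1}]^T\in\mathbb{C}^N$ with $\|\mathbf{w}\|_0=s$, where $s\geq 1$, and let $\hat{\mathbf{w}}\in\mathbb{C}^N$ (an approximation of $\mathbf{w}$). Let $q=\min_{i:\,w_i\neq 0}|w_i|$, and let $d=s+\tau$ where $\tau>0$ is an integer and $d<N$. If $$\|\mathbf{w}-\hat{\mathbf{w}}\|_2^2\leq q^2\left(1-\frac{1}{\tau+2}\right)\quad\text{and}\quad \|\hat{\mathbf{w}}\|_0\geq d,$$ then $$\mathrm{support}(H_d(\hat{\mathbf{w}}))\supseteq\mathrm{support}(\mathbf{w}).$$
   Context: For $\mathbf{x}=[x_0,\dots,x_{N-1}]^T\in\mathbb{C}^N$, $\mathrm{support}(\mathbf{x})=\{i\in\{0,\dots,N-1\}: x_i\neq 0\}$ and $\|\mathbf{x}\|_0=|\mathrm{support}(\mathbf{x})|$ is the number of nonzero coefficients. Hard threshold operator: for a positive integer $d$, $H_d(\mathbf{x})$ is the vector obtained from $\mathbf{x}$ by keeping unchanged the coefficients with the $d$ largest absolute values and setting all others to zero. In case of ties, all tying coefficients are kept: $H_d(\mathbf{x})_i=x_i$ if $|x_i|$ is at least the $d$-th largest value (counted with multiplicity) among $|x_0|,\dots,|x_{N-1}|$, and $H_d(\mathbf{x})_i=0$ otherwise. For example, $H_2([2,-2,1,0]^T)=H_1([2,-2,1,0]^T)=[2,-2,0,0]^T$. *)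

(* Defs.v *)
From mathcomp Require Import all_boot all_order all_algebra.
From mathcomp Require Import reals complex.
Set Implicit Arguments.
Unset Strict Implicit.
Unset Printing Implicit Defensive.
Import Order.TTheory GRing.Theory Num.Theory.
Import ComplexField.Normc.

Local Open Scope ring_scope.

Section ComplexVectors.
Variables (R : realType) (N : nat).
Implicit Types x : 'cV[R[i]]_N.

Definition vsupport x : {set 'I_N} := [set i | x i 0 != 0].

Definition l0norm x : nat := #|vsupport x|.

(* The modulus is [normc], which is valued in R; the generic norm `|z| on R[i]
   is valued in R[i], whose order is only partial. *)
Definition l2norm x : R := Num.sqrt (\sum_(i < N) normc (x i 0) ^+ 2).

Definition is_min_modulus x (q : R) : Prop :=
  (exists2 i, x i 0 != 0 & normc (x i 0) = q) /\
  (forall i, x i 0 != 0 -> q <= normc (x i 0)).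

Definition moduli x : seq R := [seq normc (x i 0) | i <- enum 'I_N].

(* The d-th largest modulus, with multiplicity, counted from d = 1; meaningful
   for 0 < d <= N only. *)
Definition kth_modulus (d : nat) x : R := nth 0 (sort >=%R (moduli x)) d.-1.

Definition hard_threshold (d : nat) x : 'cV[R[i]]_N :=
  \col_i (if kth_modulus d x <= normc (x i 0) then x i 0 else 0).

End ComplexVectors.

(* Main.v *)
Require Import Defs.
From mathcomp Require Import all_boot all_order all_algebra.
From mathcomp Require Import reals complex.
From mathcomp Require Import ring lra.
Import Order.TTheory GRing.Theory Num.Theory.
Import ComplexField.Normc.
Local Open Scope ring_scope.

(** If an index [i] of the support of [w] is lost, then at least [d = s + tau]
    coefficients of [what] exceed [a = |what_i|] in modulus, and at least
    [tau + 1] of them lie outside the support of [w]. Writing [b > a] for the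
    smallest of these, the squared error is at least
    [(|w_i| - a)^2 + (tau + 1) b^2 > (|w_i| - a)^2 + (tau + 1) a^2], whose
    minimum over [a] is [|w_i|^2 (tau + 1) / (tau + 2)]. *)

Lemma normc_ge0 (R : rcfType) (z : R[i]) : 0 <= normc z.
Proof. by case: z => a b; rewrite sqrtr_ge0. Qed.

Lemma normc_gt0 (R : rcfType) (z : R[i]) : (0 < normc z) = (z != 0).
Proof.
rewrite lt_def normc_ge0 andbT; congr (~~ _).
by apply/eqP/eqP => [/eq0_normc//|->]; exact: normc0.
Qed.

Lemma sqr_normc_dist (R : rcfType) (y z : R[i]) :
  (normc y - normc z) ^+ 2 <= normc (y - z) ^+ 2.
Proof.
rewrite -real_normK ?num_real// ler_pXn2r ?nnegrE ?normc_ge0// ler_norml.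
have := le_normcD (y - z) z; have := le_normcD (z - y) y.
rewrite !subrK -[in normc (z - y)]opprB normcN.
by move=> h1 h2; apply/andP; split; lra.
Qed.

(** In nonincreasing order the moduli above [a] come first; were there fewer than [d] of them,
    position [d.-1] would hold a value at most [a]. *)
Lemma card_gt_kth_modulus (R : realType) (N d : nat) (x : 'cV[R[i]]_N) (a : R) :
  (0 < d <= N)%N -> a < kth_modulus d x ->
  (d <= #|[set j | (a < normc (x j 0))%R]|)%N.
Proof.
move=> /andP[d0 dN]; apply: contraTT; rewrite -ltnNge -leNgt => small.
have ge_sorted : sorted >=%O (sort >=%R (moduli x)).
  by apply: sort_sorted => u v; apply: le_total.
(* In the dual order [R^d], a nonincreasing list counts as sorted. *)
apply: (@Order.TotalTheory.DualTotalTheory.nth_count_ge _ R^d a 0 _ _ ge_sorted).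
rewrite count_sort size_sort size_map size_enum_ord count_map.
rewrite prednK// dN andbT -ltnS prednK//.
rewrite cardsE cardE -size_filter in small *.
by rewrite /enum_mem -enumT in small.
Qed.

(* Completing the square: the difference of the two sides is
   [(m - (k + 1) a)^2 / (k + 1)]. *)
Lemma sqr_dist_add_ge (R : realFieldType) (k : nat) (m a : R) :
  m ^+ 2 * (1 - 1 / k.+1%:R) <= (m - a) ^+ 2 + k%:R * a ^+ 2.
Proof.
have k0 : (0 : R) < k%:R + 1 by rewrite natr1 ltr0Sn.
rewrite -natr1 -subr_ge0.
have -> : (m - a) ^+ 2 + k%:R * a ^+ 2 - m ^+ 2 * (1 - 1 / (k%:R + 1)) =
    (m - (k%:R + 1) * a) ^+ 2 / (k%:R + 1) by field; rewrite gt_eqF.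
by rewrite divr_ge0 ?sqr_ge0// ltW.
Qed.

Theorem theorem3 (R : realType) (N s tau d : nat) (w what : 'cV[R[i]]_N) (q : R)
    (hs : l0norm w = s) (hs1 : (1 <= s)%N)
    (hq : is_min_modulus w q)
    (hd : d = (s + tau)%N) (htau : (0 < tau)%N) (hdN : (d < N)%N)
    (herr : l2norm (w - what) ^+ 2 <= q ^+ 2 * (1 - 1 / (tau + 2)%:R))
    (h0 : (d <= l0norm what)%N) :
  vsupport w \subset vsupport (hard_threshold d what).
Proof.
apply/subsetP => i iw; rewrite inE mxE; apply/negP => lost.
have wi0 : w i 0 != 0 by rewrite inE in iw.
set a := normc (what i 0).
pose L := [set j | (a < normc (what j 0))%R].
have cardL : (d <= #|L|)%N.
  (* Either [i] passes the threshold and [what] already vanishes there, so that [a = 0] and [L]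
     contains the support of [what]; or [a] lies below the threshold. *)
  move: lost; case: (leP (kth_modulus d what) _) => [_ /eqP wh0|lt_a _]; last first.
    by apply: card_gt_kth_modulus => //; rewrite (ltnW hdN) hd addn_gt0 hs1.
  apply: leq_trans h0 _; apply: subset_leq_card; apply/subsetP => j.
  by rewrite !inE /a wh0 normc0 normc_gt0.
pose T := L :\: vsupport w.
have iL : i \notin L by rewrite inE ltxx.
(* The one index beyond [tau] is gained from [i], which is in the support of [w] but not in [L]. *)
have cardT : (tau.+1 <= #|T|)%N.
  have : (#|L :&: vsupport w| < s)%N.
    rewrite -hs; apply: proper_card; apply/properP; split; first exact: subsetIr.
    by exists i; rewrite // inE (negPf iL).
  move=> lt_s; rewrite -(leq_add2l #|L :&: vsupport w|) cardsID.
  by apply: leq_trans cardL; rewrite hd addnS -addSn leq_add2r.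
have iT : i \notin T by rewrite inE (negPf iL) andbF.
have a0 : 0 <= a by exact: normc_ge0.
have sumT : tau.+1%:R * a ^+ 2 < \sum_(j in T) normc ((w - what) j 0) ^+ 2.
  apply: (@le_lt_trans _ _ (\sum_(j in T) a ^+ 2)).
    by rewrite sumr_const -[leRHS]mulr_natl ler_wpM2r ?sqr_ge0// ler_nat.
  (* A nonempty [T] makes the sum inequality strict, as needed to contradict the non-strict
     [herr]. *)
  have [j0 j0T] : exists j, j \in T by apply/card_gt0P; apply: leq_trans cardT.
  have ltT j : j \in T -> a ^+ 2 < normc ((w - what) j 0) ^+ 2.
    rewrite !inE negbK => /andP[/eqP wj0 lt_aj].
    by rewrite !mxE wj0 sub0r normcN ltr_pXn2r ?nnegrE ?normc_ge0.
  apply: ltr_sum => //.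
  by apply/hasP; exists j0; rewrite ?mem_index_enum.
have : (normc (w i 0) - a) ^+ 2 + tau.+1%:R * a ^+ 2 < l2norm (w - what) ^+ 2.
  rewrite sqr_sqrtr; last by apply: sumr_ge0 => j _; apply: sqr_ge0.
  (* Only the terms over [T] and the term at [i] are kept. *)
  rewrite (bigID (mem T))/= [ltRHS]addrC ler_ltD//.
  rewrite (bigD1 i)//= ler_wpDr//; first by apply: sumr_ge0 => j _; apply: sqr_ge0.
  by rewrite !mxE sqr_normc_dist.
apply/negP; rewrite -leNgt; apply: le_trans herr _.
(* Here [k = tau.+1], so that [k.+1] is the [tau + 2] of [herr]. *)
apply: le_trans (sqr_dist_add_ge _ _ _ _); rewrite addn2.
case: hq => -[i0 _ q_i0] q_min.
have q0 : 0 <= q by rewrite -q_i0 normc_ge0.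
apply: ler_wpM2r; last by rewrite ler_pXn2r ?nnegrE ?normc_ge0// q_min.
by rewrite subr_ge0 div1r invf_le1 ?ltr0Sn// ler1n.
Qed.
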